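(* Let $\mathrm{CAL}$ be any unnormalized binned squared error (UBSE). Then $\mathrm{CAL}$ is interim truthful: for every positive integer $T$, every ground-truth vector $\boldsymbol p=(p_1,\ldots,p_T)\in[0,1]^T$ and every report vector $\boldsymbol r=(r_1,\ldots,r_T)\in[0,1]^T$, $$\mathbb E_{\boldsymbol y\sim\boldsymbol p}[\mathrm{CAL}(\boldsymbol p,\boldsymbol y)]\le \mathbb E_{\boldsymbol y\sim\boldsymbol p}[\mathrm{CAL}(\boldsymbol r,\boldsymbol y)].$$
   Context: Notation: $\boldsymbol y\sim\boldsymbol p$ means that $\boldsymbol y=(y_1,\ldots,y_T)\in\{0,1\}^T$ has independent coordinates, $y_t$ being Bernoulli with mean $p_t$. $[T]=\{1,\ldots,T\}$. UBSE: an error metric $\mathrm{CAL}(\boldsymbol r,\boldsymbol p)$, taking as input a report vector $\boldsymbol r=(r_1,\ldots,r_T)\in[0,1]^T$ and a vector $\boldsymbol p=(p_1,\ldots,p_T)\in[0,1]^T$ (which may in particular be a vector in $\{0,1\}^T$), is called an unnormalized binned squared error if it is computed as follows. (1) Partition the index set into $k$ disjoint bins, $[T]=B_1\cup\cdots\cup B_k$; the partition $\mathcal B=(B_1,\ldots,B_k)$ (including $k$) may be randomized, and its distribution may depend arbitrarily on $\boldsymbol r$ but not on $\boldsymbol p$. (2) Put $\Delta_i:=\frac1T\sum_{t\in B_i}(r_t-p_t)$ for each $i$. (3) $\mathrm{CAL}(\boldsymbol r,\boldsymbol p):=\mathbb E_{\mathcal B}\left[\sum_{i=1}^k\Delta_i^2\right]$,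 where the expectation is over the randomness of the partition $\mathcal B$. *)

(* Defs.v *)
From mathcomp Require Import all_boot all_order all_algebra.
From mathcomp Require Import all_classical all_reals all_analysis.

Set Implicit Arguments.
Unset Strict Implicit.
Unset Printing Implicit Defensive.

Import Order.TTheory GRing.Theory Num.Theory.

Local Open Scope ring_scope.

Definition in_cube (R : realType) (T : nat) (x : 'rV[R]_T) : Prop :=
  forall t, 0 <= x 0 t <= 1.

(* Only the values at vectors of [0,1]^T are ever constrained or used. *)
Definition error_metric (R : realType) : Type :=
  forall T : nat, 'rV[R]_T -> 'rV[R]_T -> R.

(* The number of bins is [size bs]; bins may be empty. *)
Definition bin_partition (T : nat) (bs : seq {set 'I_T}) : Prop :=
  pairwise (fun A B : {set 'I_T} => [disjoint A & B]) bs /\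
  \bigcup_(A <- bs) A = [set: 'I_T]%SET.

Definition bin_error (R : realType) (T : nat) (r p : 'rV[R]_T)
    (A : {set 'I_T}) : R :=
  T%:R^-1 * \sum_(t in A) (r 0 t - p 0 t).

(* The probability space and the random partition [bins] are chosen after r
   but before p.  There are countably many sequences of bins, so measurability
   of [bins] amounts to measurability of its fibres. *)
Definition UBSE (R : realType) (CAL : error_metric R) : Prop :=
  forall (T : nat) (r : 'rV[R]_T), (0 < T)%N -> in_cube r ->
  exists (d : measure_display) (Omega : measurableType d)
         (P : probability Omega R) (bins : Omega -> seq {set 'I_T}),
  [/\ forall w, bin_partition (bins w),
      forall bs, measurable [set w | bins w = bs]%classic
    & forall p : 'rV[R]_T, in_cube p ->
        (CAL T r p)%:E =
        'E_P[fun w => (\sum_(A <- bins w) bin_error r p A ^+ 2)%R]%E].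

Definition outcome_vec (R : realType) (T : nat) (y : {ffun 'I_T -> bool}) :
  'rV[R]_T := \row_t (y t)%:R.

(* Expectation of f(y) for y ~ p, i.e. under the product of the laws
   Bernoulli(p_t) on {0,1}^T. *)
Definition expect_outcome (R : realType) (T : nat) (p : 'rV[R]_T)
    (f : 'rV[R]_T -> R) : R :=
  \sum_(y : {ffun 'I_T -> bool})
    (\prod_(t < T) bernoulli_pmf (p 0 t) (y t)) * f (outcome_vec R y).

Definition interim_truthful (R : realType) (CAL : error_metric R) : Prop :=
  forall (T : nat) (p r : 'rV[R]_T), (0 < T)%N -> in_cube p -> in_cube r ->
  expect_outcome p (CAL T p) <= expect_outcome p (CAL T r).

(* Main.v *)
Require Import Defs.
From mathcomp Require Import all_boot all_order all_algebra.
From mathcomp Require Import all_classical all_reals all_analysis.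
From mathcomp Require Import measurable_realfun ring.

(** Fix a partition of [T] into bins.  The bias-variance decomposition of each
    [Delta_i] shows that the expected error of the report [r] is
    [sum_i Delta_i(r, p)^2 + T^-2 * sum_t p_t (1 - p_t)].  The variance term
    depends neither on the partition nor on [r], so averaging over the random
    partition of [r] leaves it unchanged: it bounds the expected error from
    below, and it is attained at [r = p], where every bias vanishes. *)

Set Implicit Arguments.
Unset Strict Implicit.
Unset Printing Implicit Defensive.

Import Order.TTheory GRing.Theory Num.Theory.

Local Open Scope ring_scope.

Lemma eq_expect_outcome (R : realType) (T : nat) (p : 'rV[R]_T)
    (f g : 'rV[R]_T -> R) :
  (forall y, f (outcome_vec R y) = g (outcome_vec R y)) ->
  expect_outcome p f = expect_outcome p g.
Proof. by move=> fg; apply: eq_bigr => y _; rewrite fg. Qed.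

Lemma expect_outcome_sum (R : realType) (T : nat) (p : 'rV[R]_T)
    (I : Type) (s : seq I) (P : pred I) (f : I -> 'rV[R]_T -> R) :
  expect_outcome p (fun y => \sum_(i <- s | P i) f i y) =
  \sum_(i <- s | P i) expect_outcome p (f i).
Proof.
rewrite /expect_outcome exchange_big; apply: eq_bigr => y _.
by rewrite mulr_sumr.
Qed.

Lemma expect_outcomeZ (R : realType) (T : nat) (p : 'rV[R]_T) (c : R)
    (f : 'rV[R]_T -> R) :
  expect_outcome p (fun y => c * f y) = c * expect_outcome p f.
Proof.
by rewrite /expect_outcome mulr_sumr; apply: eq_bigr => y _; rewrite mulrCA.
Qed.

(** Independence of the coordinates: each Bernoulli weight joins its factor [G t], and distributing
    a product of two-term sums over all choice functions yields the sum over outcomes. *)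
Lemma expect_outcome_prod (R : realType) (T : nat) (p : 'rV[R]_T)
    (G : 'I_T -> R -> R) :
  expect_outcome p (fun y => \prod_t G t (y 0 t)) =
  \prod_t (p 0 t * G t 1 + (1 - p 0 t) * G t 0).
Proof.
pose F t b := bernoulli_pmf (p 0 t) b * G t b%:R.
transitivity (\sum_(y : {ffun 'I_T -> bool}) \prod_t F t (y t)).
  apply: eq_bigr => y _; rewrite -big_split; apply: eq_bigr => t _.
  by rewrite /F mxE.
by rewrite -bigA_distr_bigA; apply: eq_bigr => t _; rewrite big_bool.
Qed.

Lemma expect_outcome_residual2 (R : realType) (T : nat) (r p : 'rV[R]_T)
    (s t : 'I_T) :
  expect_outcome p (fun y => (r 0 s - y 0 s) * (r 0 t - y 0 t)) =
  (r 0 s - p 0 s) * (r 0 t - p 0 t) + (s == t)%:R * (p 0 s * (1 - p 0 s)).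
Proof.
(* Padding with ones turns the two residuals into a product over all coordinates; the two separate
   tests also cover [s = t], where both factors sit at one coordinate. *)
pose G u x := (if u == s then r 0 s - x else 1) *
              (if u == t then r 0 t - x else 1).
have -> : expect_outcome p (fun y => (r 0 s - y 0 s) * (r 0 t - y 0 t)) =
          expect_outcome p (fun y => \prod_u G u (y 0 u)).
  apply: eq_expect_outcome => y.
  by rewrite big_split /= -!big_mkcond !big_pred1_eq.
rewrite expect_outcome_prod (bigD1 s) //=.
(* Coordinates other than [s] and [t] contribute 1. The diagonal case is p (r - 1)^2 + (1 - p) r^2 =
   (r - p)^2 + p (1 - p); off the diagonal, [s] and [t] each contribute their mean residual. *)
rewrite /G => {G}; have [<-|st] := eqVneq s t.
  rewrite big1 => [|u us]; first by rewrite eqxx mul1r; ring.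
  by rewrite (negPf us); ring.
have ts : t != s by rewrite eq_sym.
rewrite (bigD1 t) //= big1 => [|u /andP[us ut]].
  by rewrite !eqxx (negPf ts) mul0r; ring.
by rewrite (negPf us) (negPf ut); ring.
Qed.

(** Squaring gives a double sum over the bin, in which covariances survive only on the diagonal. *)
Lemma expect_bin_error2 (R : realType) (T : nat) (r p : 'rV[R]_T)
    (A : {set 'I_T}) :
  expect_outcome p (fun y => bin_error r y A ^+ 2) =
  bin_error r p A ^+ 2 + T%:R^-1 ^+ 2 * \sum_(t in A) p 0 t * (1 - p 0 t).
Proof.
have sqE (q : 'rV[R]_T) : bin_error r q A ^+ 2 =
    T%:R^-1 ^+ 2 *
    \sum_(s in A) \sum_(t in A) (r 0 s - q 0 s) * (r 0 t - q 0 t).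
  rewrite exprMn [X in _ * X]expr2 mulr_suml.
  by congr (_ * _); apply: eq_bigr => s _; rewrite mulr_sumr.
rewrite (funext sqE) expect_outcomeZ sqE -mulrDr.
rewrite expect_outcome_sum -big_split; congr (_ * _).
apply: eq_bigr => s sA /=; rewrite expect_outcome_sum.
rewrite (eq_bigr _ (fun t _ => expect_outcome_residual2 r p s t)).
rewrite big_split /=; congr (_ + _).
rewrite (bigD1 s) //= eqxx mul1r big1 ?addr0 // => t /andP[_ ts].
by rewrite eq_sym (negPf ts) mul0r.
Qed.

(** Merges the variances of the separate bins into one sum. In the induction, the head bin is
    disjoint from the union of the later ones. *)
Lemma big_pairwise_disjoint (V : nmodType) (I : finType)
    (bs : seq {set I}) (f : I -> V) :
  pairwise (fun A B : {set I} => [disjoint A & B]) bs ->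
  \sum_(A <- bs) \sum_(t in A) f t = \sum_(t in \bigcup_(A <- bs) A) f t.
Proof.
elim: bs => [|A bs IH]; first by rewrite !big_nil big_set0.
rewrite pairwise_cons => /andP[/allP dA /IH {}IH].
have dAbs : [disjoint A & \bigcup_(B <- bs) B].
  rewrite big_seq; elim/big_rec: _ => [|B C /dA].
    by rewrite -finset.setI_eq0 finset.setI0.
  rewrite -!finset.setI_eq0 finset.setIUr => /eqP-> /eqP->.
  by rewrite finset.setU0.
by rewrite !big_cons IH -bigU //; apply: eq_bigl => t; rewrite !inE.
Qed.

(** The variance of the mean outcome (1/T) sum_t y_t under y ~ p. *)
Definition outcome_variance (R : realType) (T : nat) (p : 'rV[R]_T) : R :=
  T%:R^-1 ^+ 2 * \sum_t p 0 t * (1 - p 0 t).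

Lemma expect_binned_error (R : realType) (T : nat) (r p : 'rV[R]_T)
    (bs : seq {set 'I_T}) : bin_partition bs ->
  expect_outcome p (fun y => \sum_(A <- bs) bin_error r y A ^+ 2) =
  \sum_(A <- bs) bin_error r p A ^+ 2 + outcome_variance p.
Proof.
case=> dbs cbs; rewrite expect_outcome_sum.
under eq_bigr do rewrite expect_bin_error2.
rewrite big_split -mulr_sumr big_pairwise_disjoint // cbs /=.
by under [X in _ + _ * X]eq_bigl do rewrite inE.
Qed.

Lemma in_cube_outcome_vec (R : realType) (T : nat)
    (y : {ffun 'I_T -> bool}) : in_cube (outcome_vec R y).
Proof. by move=> t; rewrite mxE; case: (y t); rewrite ?lexx ?ler01. Qed.

(** Every preimage is a countable union of fibres of [X]. This makes any function of the random
    partition measurable. *)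
Lemma measurable_comp_countable (d d' : measure_display)
    (Omega : measurableType d) (W : measurableType d') (S : countType)
    (X : Omega -> S) (g : S -> W) :
  (forall s, measurable [set w | X w = s]%classic) ->
  measurable_fun setT (g \o X).
Proof.
move=> mX _ B _; rewrite setTI.
have -> : ((g \o X) @^-1` B =
    \bigcup_(s in setT) [set w | X w = s /\ B (g s)])%classic.
  apply/seteqP; split=> [w Bw|w [s _ [/= <-]] //].
  by exists (X w).
apply: countable_bigcupT_measurable => // s.
have [Bs|nBs] := pselect (B (g s)).
  by rewrite (_ : [set _ | _] = [set w | X w = s])%classic //;
    apply/seteqP; split=> w //= [].
by rewrite (_ : [set _ | _] = set0)%classic //; apply/seteqP; split=> w //= [].
Qed.

(** Since the law of the partition ignores the second argument of [CAL], one space [Omega] serves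
    all outcomes. The expectations over outcomes and partitions can then be swapped, and the
    decomposition applies at each fixed [w]. *)
Lemma expect_UBSE (R : realType) (T : nat) (r p : 'rV[R]_T)
    (CAL : error_metric R) (d : measure_display) (Omega : measurableType d)
    (P : probability Omega R) (bins : Omega -> seq {set 'I_T}) :
    in_cube p ->
    (forall w, bin_partition (bins w)) ->
    (forall bs, measurable [set w | bins w = bs]%classic) ->
    (forall q, in_cube q -> (CAL T r q)%:E =
      'E_P[fun w => (\sum_(A <- bins w) bin_error r q A ^+ 2)%R]%E) ->
  ((expect_outcome p (CAL T r))%:E = \int[P]_w
    (\sum_(A <- bins w) bin_error r p A ^+ 2 + outcome_variance p)%:E)%E.
Proof.
move=> pC part mbins CALE.
pose h (y : {ffun 'I_T -> bool}) w := (\sum_(A <- bins w) bin_error r (outcome_vec R y) A ^+ 2)%R.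
have wt0 (y : {ffun 'I_T -> bool}) : 0 <= \prod_(t < T) bernoulli_pmf (p 0 t) (y t).
  by apply: prodr_ge0 => t _; exact: bernoulli_pmf_ge0.
have h0 y w : 0 <= h y w by apply: sumr_ge0 => A _; exact: sqr_ge0.
have mh y : measurable_fun setT (EFin \o h y).
  exact: (measurable_comp_countable (fun bs =>
    (\sum_(A <- bs) bin_error r (outcome_vec R y) A ^+ 2)%:E)).
pose F (y : {ffun 'I_T -> bool}) w :=
  ((\prod_(t < T) bernoulli_pmf (p 0 t) (y t))%:E * (h y w)%:E)%E.
transitivity (\sum_(y : {ffun 'I_T -> bool}) \int[P]_w F y w)%E.
  rewrite -sumEFin; apply: eq_bigr => y _.
  rewrite EFinM (CALE _ (in_cube_outcome_vec R y)) ge0_integralZl_EFin //.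
  - by rewrite expectation.unlock.
  - by move=> w _; rewrite lee_fin.
  - exact: mh.
rewrite -ge0_integral_sum //.
- apply: eq_integral => w _; rewrite -expect_binned_error // -sumEFin.
  by apply: eq_bigr => y _; rewrite EFinM.
- by move=> y; apply: measurable_funeM; exact: mh.
- by move=> y w _; rewrite /F -EFinM lee_fin mulr_ge0.
Qed.

Theorem theorem3p2 (R : realType) (CAL : error_metric R) :
  UBSE CAL -> interim_truthful CAL.
Proof.
move=> CALU T p r T0 pC rC.
have V0 : 0 <= outcome_variance p.
  rewrite mulr_ge0 ?exprn_ge0 ?invr_ge0 // sumr_ge0 // => t _.
  by have /andP[pt0 pt1] := pC t; rewrite mulr_ge0 // subr_ge0.
(* The partitions for the reports [p] and [r] may live on unrelated spaces, so the two sides are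
   compared through a constant. *)
apply: (@le_trans _ _ (outcome_variance p)).
  have [d [W [P [bins [part mbins CALE]]]]] := CALU T p T0 pC.
  rewrite -lee_fin (expect_UBSE pC part mbins CALE).
  have bin0 w : \sum_(A <- bins w) bin_error p p A ^+ 2 = 0.
    rewrite big1 // => A _; rewrite /bin_error big1 ?mulr0 ?expr0n //.
    by move=> t _; rewrite subrr.
  under eq_integral do rewrite bin0 add0r.
  by rewrite integral_cst // [X in (_ * X)%E]probability_setT mule1.
have [d [W [P [bins [part mbins CALE]]]]] := CALU T r T0 rC.
rewrite -lee_fin (expect_UBSE pC part mbins CALE).
(* As [P] has mass 1, the constant is its own integral, which leaves a pointwise comparison of
   integrands. *)
rewrite -[leLHS]mule1 -(probability_setT P) -integral_cst //.
apply: ge0_le_integral => //.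
- exact: (measurable_comp_countable (fun bs =>
    (\sum_(A <- bs) bin_error r p A ^+ 2 + outcome_variance p)%:E)).
- move=> w _; rewrite lee_fin lerDr; apply: sumr_ge0 => A _; exact: sqr_ge0.
Qed.
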